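(* Let $\lambda\in\mathbb C^\times$. (1) The $\mathfrak g$-module $\Omega(\lambda,\overline0)$ has a unique irreducible submodule, namely $t\,\Omega(\lambda,\overline 0)=t\,\mathbb C[t]$. (2) For $\overline\alpha\in\mathbb C^p$, the $\mathfrak g$-module $\Omega(\lambda,\overline\alpha)$ is irreducible if and only if $\overline\alpha\neq\overline0$.
   Context: All vector spaces and algebras are over $\mathbb C$; $\mathbb C^\times=\mathbb C\setminus\{0\}$; $p>1$ is a fixed integer; $\overline0=(0,\dots,0)\in\mathbb C^p$. Gap-$p$ Virasoro algebra. $\mathfrak g$ is the Lie algebra with basis $\{L_n, I_n^{(i)}, C_j : n\in\mathbb Z, 1\le i\le p-1, 0\le j\le \lfloor p/2\rfloor\}$ and brackets $[L_m,L_n]=(m-n)L_{m+n}+\frac1{12}(m^3-m)\delta_{m+n,0}C_0$, $[I_m^{(i)},I_n^{(j)}]=(m+\frac ip)\delta_{i+j,p}\delta_{m+n+1,0}C_i$, $[L_m,I_n^{(i)}]=-(n+\frac ip)I_{m+n}^{(i)}$, all $C_k$ central; one sets $C_i:=C_{p-i}$ for $\lfloor p/2\rfloor<i\le p-1$. For $\lambda\in\mathbb C^\times$ and $\overline\alpha=(\alpha_0,\alpha_1,\dots,\alpha_{p-1})\in\mathbb C^p$, $\Omega(\lambda,\overline\alpha)$ denotes the $\mathfrak g$-module on the polynomial ring $\mathbb C[t]$ with $$L_nf(t)=\lambda^n(t+\alpha_0n)f(t+n),\quad I_n^{(i)}f(t)=\alpha_i\lambda^nf\bigl(t+n+\tfrac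 ip\bigr),\quad C_jf(t)=0,$$ for $n\in\mathbb Z$, $1\le i\le p-1$, $0\le j\le p-1$, $f(t)\in\mathbb C[t]$. *)

(* Defs.v *)
From HB Require Import structures.
From mathcomp Require Import all_boot all_order all_algebra.
From mathcomp Require Import finmap.
From mathcomp Require Import boolp classical_sets reals.
From mathcomp.multinomials Require Import monalg.
From mathcomp Require Import complex.
From mathcomp Require Import ring zify.

Set Implicit Arguments.
Unset Strict Implicit.
Unset Printing Implicit Defensive.

Import Order.TTheory GRing.Theory Num.Theory.
Local Open Scope ring_scope.

HB.mixin Record Lmodule_isLieAlgebra (K : fieldType) g of GRing.Lmodule K g := {
  lie_bracket : g -> g -> g;
  lie_linearl : forall y, linear (lie_bracket^~ y);
  lie_linearr : forall x, linear (lie_bracket x);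
  lie_alternating : forall x, lie_bracket x x = 0;
  lie_jacobi : forall x y z,
    lie_bracket x (lie_bracket y z) + lie_bracket y (lie_bracket z x)
    + lie_bracket z (lie_bracket x y) = 0
}.

#[short(type="lieAlgType")]
HB.structure Definition LieAlgebra (K : fieldType) :=
  {g of GRing.Lmodule K g & Lmodule_isLieAlgebra K g}.

Record lieModule (K : fieldType) (g : lieAlgType K) := LieModule {
  lm_sort :> lmodType K;
  lm_act : g -> lm_sort -> lm_sort;
  lm_linearl : forall v, linear (lm_act^~ v);
  lm_linearr : forall x, linear (lm_act x);
  lm_bracket : forall x y v,
    lm_act (lie_bracket x y) v
    = lm_act x (lm_act y v) - lm_act y (lm_act x v)
}.

Section Submodules.
Variables (K : fieldType) (g : lieAlgType K).

Record lieSubmodule (M : lieModule g) := LieSubmodule {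
  lsm_set :> set M;
  lsm_0 : lsm_set 0;
  lsm_linear : forall (c : K) (v w : M),
    lsm_set v -> lsm_set w -> lsm_set (c *: v + w);
  lsm_act : forall (x : g) (v : M), lsm_set v -> lsm_set (lm_act x v)
}.

Definition irreducible (M : lieModule g) : Prop :=
  (exists v : M, v <> 0) /\
  forall N : lieSubmodule M,
    N = [set 0]%classic :> set M \/ N = setT :> set M.

Section AsModule.
Variables (M : lieModule g) (N : lieSubmodule M).

Definition as_module_sort : Type := {v : M | v \in (N : set M)}.

HB.instance Definition _ := SubChoice.on as_module_sort.

Fact as_module_submod_closed : submod_closed (mem (N : set M)).
Proof.
split; first exact/mem_set/lsm_0.
by move=> c v w /set_mem Nv /set_mem Nw; exact/mem_set/lsm_linear.
Qed.

HB.instance Definition _ :=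
  GRing.SubChoice_isSubLmodule.Build K M _ as_module_sort
    (GRing.submod_closed_semi as_module_submod_closed).

Fact as_module_act_subproof (x : g) (v : as_module_sort) :
  lm_act x (val v) \in (N : set M).
Proof. exact/mem_set/lsm_act/set_mem/(valP v). Qed.

Definition as_module_act (x : g) (v : as_module_sort) : as_module_sort :=
  Sub (lm_act x (val v)) (as_module_act_subproof x v).

Fact as_module_linearl v : linear (as_module_act^~ v).
Proof. by move=> c x y; apply: val_inj; rewrite /= lm_linearl. Qed.

Fact as_module_linearr x : linear (as_module_act x).
Proof. by move=> c v w; apply: val_inj; rewrite /= lm_linearr. Qed.

Fact as_module_bracket x y v :
  as_module_act (lie_bracket x y) v
  = as_module_act x (as_module_act y v) - as_module_act y (as_module_act x v).
Proof. by apply: val_inj; rewrite /= lm_bracket. Qed.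

Definition as_module : lieModule g :=
  LieModule as_module_linearl as_module_linearr as_module_bracket.

End AsModule.
End Submodules.

HB.lock Definition lin_ext (K : fieldType) (I : choiceType) (V : lmodType K)
    (phi : I -> V) (x : {malg K[I]}) : V :=
  \sum_(i <- msupp x) x@_i *: phi i.

Section LinearExtension.
Variables (K : fieldType) (I : choiceType) (V : lmodType K).
Implicit Types (phi : I -> V) (x y : {malg K[I]}).

Lemma lin_extEw phi x (d : {fset I}) : (msupp x `<=` d)%fset ->
  lin_ext phi x = \sum_(i <- d) x@_i *: phi i.
Proof.
by move=> xd; rewrite unlock; apply: big_fset_incl => // i _ /mcoeff_outdom ->; rewrite scale0r.
Qed.

Lemma lin_ext_linear phi : linear (lin_ext phi).
Proof.
move=> c x y; pose d := (msupp (c *: x + y) `|` (msupp x `|` msupp y))%fset.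
rewrite !(@lin_extEw _ _ d) ?fsubsetUl //; first last.
- by rewrite /d fsubsetU // fsubsetUl orbT.
- by rewrite /d fsubsetU // fsubsetUr orbT.
rewrite scaler_sumr -big_split /=; apply: eq_bigr => i _.
by rewrite mcoeffD mcoeffZ scalerDl scalerA.
Qed.

Lemma lin_extU phi i : lin_ext phi << i >> = phi i.
Proof.
rewrite (@lin_extEw _ _ [fset i]%fset) ?msuppU_le //.
by rewrite big_seq_fset1 mcoeffUU scale1r.
Qed.

Lemma lin_ext_linear_fun c phi psi x :
  lin_ext (fun i => c *: phi i + psi i) x = c *: lin_ext phi x + lin_ext psi x.
Proof.
rewrite unlock scaler_sumr -big_split /=; apply: eq_bigr => i _.
by rewrite scalerDr !scalerA mulrC.
Qed.

Lemma malg_basis_ind (P : {malg K[I]} -> Prop) : P 0 ->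
  (forall c i x, P x -> P (c *: << i >> + x)) -> forall x, P x.
Proof.
move=> P0 PS x; rewrite [x]monalgE.
elim: (enum_fset (msupp x)) => [|i s IHs]; first by rewrite big_nil.
rewrite big_cons (_ : << _ *g i >> = x@_i *: << i >>); first exact: PS.
by apply/malgP => j; rewrite mcoeffZ !mcoeffU mulrnAr mulr1.
Qed.

End LinearExtension.

HB.instance Definition _ (K : fieldType) (I : choiceType) (V : lmodType K)
    (phi : I -> V) :=
  GRing.isLinear.Build K {malg K[I]} V _ (lin_ext phi) (lin_ext_linear phi).

(* [gapL n], [gapI n i] and [gapC j] label the basis vectors L_n, I_n^(i) (for
   0 < i < p) and C_j (for 0 <= j <= floor(p/2)). *)
Inductive gap_index (p : nat) :=
  | gapL of int
  | gapI of int & {i : 'I_p | (0 < i)%N}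
  | gapC of 'I_(p./2).+1.

Arguments gapL {p}.
Arguments gapI {p}.
Arguments gapC {p}.

Section GapIndexChoice.
Variable p : nat.

Definition gap_index_encode (k : gap_index p) :
    int + int * {i : 'I_p | (0 < i)%N} + 'I_(p./2).+1 :=
  match k with
  | gapL n => inl (inl n)
  | gapI n i => inl (inr (n, i))
  | gapC j => inr j
  end.

Definition gap_index_decode
    (k : int + int * {i : 'I_p | (0 < i)%N} + 'I_(p./2).+1) : gap_index p :=
  match k with
  | inl (inl n) => gapL n
  | inl (inr (n, i)) => gapI n i
  | inr j => gapC j
  end.

Lemma gap_index_encodeK : cancel gap_index_encode gap_index_decode.
Proof. by case. Qed.

HB.instance Definition _ := Choice.copy (gap_index p) (can_type gap_index_encodeK).

End GapIndexChoice.

(* The convention C_i := C_(p-i) for floor(p/2) < i < p. *)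
Definition central_index (p i : nat) : 'I_(p./2).+1 :=
  inord (if (i <= p./2)%N then i else (p - i)%N).

Lemma central_index_sym (p i j : nat) : (i + j)%N = p ->
  central_index p i = central_index p j.
Proof.
move=> ijp; congr inord.
have p2 : p = (p %% 2 + p./2 * 2)%N by rewrite -divn2 addnC -divn_eq.
have := ltn_pmod p (isT : (0 < 2)%N).
by case: ifP; case: ifP; lia.
Qed.

(* Over an arbitrary family [e]: on the concrete free module below, unification
   tends to unfold the operations of [{malg _}] and diverge. *)
Section GapBracketBasis.
Variables (F : numFieldType) (p : nat) (V : lmodType F).
Variable e : gap_index p -> V.

Definition gap_bracket_basis (a b : gap_index p) : V :=
  match a, b with
  | gapL m, gapL n =>
      (m - n)%:~R *: e (gapL (m + n))
      + (if m + n == 0 then 12%:R^-1 * (m ^+ 3 - m)%:~R else 0)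
        *: e (gapC ord0)
  | gapL m, gapI n i =>
      - (n%:~R + (val i)%:R / p%:R) *: e (gapI (m + n) i)
  | gapI n i, gapL m =>
      (n%:~R + (val i)%:R / p%:R) *: e (gapI (m + n) i)
  | gapI m i, gapI n j =>
      (if (val i + val j == p :> nat)%N && (m + n + 1 == 0)
       then m%:~R + (val i)%:R / p%:R else 0)
      *: e (gapC (central_index p (val i)))
  | gapC _, _ | _, gapC _ => 0
  end.

Let scaleN (c d : F) (u : V) : c = - d -> c *: u = - (d *: u).
Proof. by move=> ->; rewrite scaleNr. Qed.

Let scaleND (c d c' d' : F) (u v : V) :
  c = - c' -> d = - d' -> c *: u + d *: v = - (c' *: u + d' *: v).
Proof. by move=> -> ->; rewrite !scaleNr opprD. Qed.

Lemma gap_bracket_basisC a b :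
  gap_bracket_basis a b = - gap_bracket_basis b a.
Proof.
case: a b => [m|m i|j] [n|n i'|j'] /=; try by rewrite oppr0.
- rewrite [n + m]addrC; apply: scaleND; first by rewrite -mulrNz opprB.
  case: eqP => [mn0|_]; last by rewrite oppr0.
  have -> : n = - m by apply/eqP; rewrite -addr_eq0 addrC mn0.
  by rewrite -mulrN -mulrNz; congr (_ * _%:~R); ring.
- exact: scaleN.
- by apply: scaleN; rewrite opprK.
rewrite addnC [n + m]addrC.
case: ifP => [/andP[/eqP ijp /eqP mn0]|_]; last by rewrite !scale0r oppr0.
rewrite (central_index_sym ijp); apply: scaleN.
have -> : n = - m - 1 by lia.
have pj : p%:R = (val i')%:R + (val i)%:R :> F by rewrite -natrD ijp.
have p0 : p%:R != 0 :> F.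
  by rewrite pnatr_eq0 -ijp -lt0n ltn_addr //; exact: (valP i').
have -> : (val i)%:R = p%:R - (val i')%:R :> F by rewrite pj addrC addKr.
by rewrite rmorphB rmorphN /=; field.
Qed.

Variable br : V -> V -> V.
Hypothesis brDl : forall x x' y, br (x + x') y = br x y + br x' y.
Hypothesis brZl : forall c x y, br (c *: x) y = c *: br x y.
Hypothesis brDr : forall x y y', br x (y + y') = br x y + br x y'.
Hypothesis brZr : forall c x y, br x (c *: y) = c *: br x y.
Hypothesis brE : forall a b, br (e a) (e b) = gap_bracket_basis a b.
Hypothesis e_ind : forall P : V -> Prop,
  P 0 -> (forall c k x, P x -> P (c *: e k + x)) -> forall x, P x.

Let br0l y : br 0 y = 0.
Proof. by rewrite -[X in br X](scale0r 0) brZl scale0r. Qed.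

Let br0r x : br x 0 = 0.
Proof. by rewrite -[X in br _ X](scale0r 0) brZr scale0r. Qed.

Let brC x y : br x y = - br y x.
Proof.
elim/e_ind: x y => [y|c a x IHx y]; first by rewrite br0l br0r oppr0.
rewrite brDl brZl brDr brZr opprD -IHx -scalerN; congr (_ *: _ + _).
elim/e_ind: y => [|d b y IHy]; first by rewrite br0l br0r oppr0.
by rewrite brDl brZl brDr brZr opprD -IHy -scalerN !brE gap_bracket_basisC.
Qed.

Lemma gap_alternating_subproof x : br x x = 0.
Proof.
apply/eqP; have /eqP := brC x x.
by rewrite -addr_eq0 -mulr2n -scaler_nat scaler_eq0 pnatr_eq0.
Qed.

Let jac x y z : V := br x (br y z) + br y (br z x) + br z (br x y).

Let jac_rot x y z : jac x y z = jac y z x.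
Proof. by rewrite /jac -addrA addrC. Qed.

Let jac0 y z : jac 0 y z = 0.
Proof. by rewrite /jac !(br0l, br0r) !addr0. Qed.

Let jac_lin c x x' y z :
  jac x y z = 0 -> jac x' y z = 0 -> jac (c *: x + x') y z = 0.
Proof.
rewrite /jac !(brDl, brZl, brDr, brZr) => x0 x'0.
rewrite (addrACA _ (br x' _)) (addrACA _ (br x' _ + _)) -!scalerDr x0 x'0.
by rewrite scaler0 addr0.
Qed.

Let comb3 (a1 b1 a2 b2 a3 b3 : F) (u v : V) :
  a1 + a2 + a3 = 0 -> b1 + b2 + b3 = 0 ->
  (a1 *: u + b1 *: v) + (a2 *: u + b2 *: v) + (a3 *: u + b3 *: v) = 0.
Proof.
move=> a0 b0; rewrite (addrACA _ (b1 *: v)) (addrACA _ (b1 *: v + _)).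
by rewrite -!scalerDl a0 b0 !scale0r addr0.
Qed.

Let jacLLL m n k : jac (e (gapL m)) (e (gapL n)) (e (gapL k)) = 0.
Proof.
rewrite /jac !brE /= !(brDr, brZr) !brE /= !scaler0 !addr0 !scalerDr !scalerA.
rewrite (_ : n + (k + m) = m + (n + k)); last by ring.
rewrite (_ : k + (m + n) = m + (n + k)); last by ring.
apply: comb3; first by rewrite !rmorphB !rmorphD /=; ring.
case: eqP => [mnk|_]; last by rewrite !mulr0 !addr0.
have -> : k = - m - n by lia.
by rewrite !(rmorphB, rmorphN, rmorphXn) /=; ring.
Qed.

Let jacLLI m n k i : jac (e (gapL m)) (e (gapL n)) (e (gapI k i)) = 0.
Proof.
rewrite /jac !brE /= !(brDr, brZr) !brE /= !scaler0 !addr0 !scalerA.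
rewrite (_ : n + (m + k) = m + (n + k)); last by ring.
rewrite (_ : (m + n) + k = m + (n + k)); last by ring.
rewrite -!scalerDl (_ : _ + _ + _ = 0) ?scale0r //.
by rewrite !rmorphB !rmorphD /=; ring.
Qed.

Let jacLII m n i k j : jac (e (gapL m)) (e (gapI n i)) (e (gapI k j)) = 0.
Proof.
rewrite /jac !brE /= !(brDr, brZr) !brE /= !scaler0 !add0r !scalerA.
rewrite [(val j + _)%N]addnC.
rewrite (_ : n + (m + k) + 1 = m + n + k + 1); last by ring.
rewrite (_ : k + (m + n) + 1 = m + n + k + 1); last by ring.
case: ifP => [/andP[/eqP ijp /eqP mnk]|_]; last by rewrite !mulr0 !scale0r addr0.
rewrite (central_index_sym ijp) -scalerDl.
by apply/eqP; rewrite scaler_eq0; apply/orP; left; apply/eqP; ring.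
Qed.

Let jac_basis a b c : jac (e a) (e b) (e c) = 0.
Proof.
case: a b c => [m|m i|j] [n|n i'|j'] [k|k i''|j''];
  rewrite ?(jacLLL, jacLLI, jacLII) //.
all: try by rewrite jac_rot ?(jacLLL, jacLLI, jacLII).
all: try by rewrite jac_rot jac_rot ?(jacLLL, jacLLI, jacLII).
all: rewrite /jac !brE /= !(brDr, brZr, br0r) ?brE /=.
all: by rewrite !(scaler0, addr0).
Qed.

Lemma gap_jacobi_subproof x y z :
  br x (br y z) + br y (br z x) + br z (br x y) = 0.
Proof.
rewrite -/(jac x y z).
elim/e_ind: x => [|c a x IHx]; first exact: jac0.
apply: jac_lin => //; rewrite jac_rot.
elim/e_ind: y {IHx} => [|d b y IHy]; first exact: jac0.
apply: jac_lin => //; rewrite jac_rot.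
elim/e_ind: z {IHy} => [|f k z IHz]; first exact: jac0.
by apply: jac_lin => //; exact: jac_basis.
Qed.

Lemma gap_module_subproof (W : lmodType F) (act : V -> W -> W) :
  (forall w, linear (act^~ w)) -> (forall x, linear (act x)) ->
  (forall a b w, act (gap_bracket_basis a b) w
                 = act (e a) (act (e b) w) - act (e b) (act (e a) w)) ->
  forall x y w, act (br x y) w = act x (act y w) - act y (act x w).
Proof.
move=> actl actr actE.
have act0l w : act 0 w = 0.
  by rewrite -[X in act X](addNr 0) -scaleN1r actl scaleN1r addNr.
have act0r x : act x 0 = 0.
  by rewrite -[X in act _ X](addNr 0) -scaleN1r actr scaleN1r addNr.
have comb (c : F) (u1 u2 v1 v2 : W) :
    c *: (u1 - u2) + (v1 - v2) = c *: u1 + v1 - (c *: u2 + v2).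
  by rewrite scalerBr opprD addrACA.
move=> x y w; elim/e_ind: x => [|c a x IHx].
  by rewrite br0l !act0l act0r subr0.
rewrite brDl brZl !actl actr IHx -comb; congr (_ *: _ + _).
elim/e_ind: y {IHx} => [|d b y IHy].
  by rewrite br0r !act0l act0r subr0.
by rewrite brDr brZr !actl actr IHy -comb brE actE.
Qed.

End GapBracketBasis.

Definition gap_vir (F : numFieldType) (p : nat) : Type := {malg F[gap_index p]}.

HB.instance Definition _ F p := GRing.Lmodule.on (gap_vir F p).

HB.lock Definition gap_basis (F : numFieldType) (p : nat) (k : gap_index p) :
  gap_vir F p := << k >>.

Section GapVirasoro.
Variables (F : numFieldType) (p : nat).

Local Notation g := (gap_vir F p).
Local Notation e := (@gap_basis F p).

Lemma gap_basis_ind (P : g -> Prop) : P 0 ->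
  (forall c k x, P x -> P (c *: e k + x)) -> forall x, P x.
Proof. by rewrite gap_basis.unlock; exact: malg_basis_ind. Qed.

Lemma lin_ext_basis (V : lmodType F) (phi : gap_index p -> V) k :
  lin_ext phi (e k) = phi k.
Proof. by rewrite gap_basis.unlock lin_extU. Qed.

Definition gap_bracket (x y : g) : g :=
  lin_ext (fun a => lin_ext (gap_bracket_basis e a) y) x.

Lemma gap_bracketE a b : gap_bracket (e a) (e b) = gap_bracket_basis e a b.
Proof. by rewrite /gap_bracket !lin_ext_basis. Qed.

Fact gap_bracket_linearl y : linear (gap_bracket^~ y).
Proof. by move=> c x x'; rewrite /gap_bracket linearP. Qed.

Fact gap_bracket_linearr x : linear (gap_bracket x).
Proof.
move=> c y y'; rewrite /gap_bracket -lin_ext_linear_fun.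
by congr lin_ext; apply/funext => a; exact: lin_ext_linear.
Qed.

Let linearDZ (V W : lmodType F) (f : V -> W) : linear f ->
  (forall u v, f (u + v) = f u + f v) * (forall c u, f (c *: u) = c *: f u).
Proof.
move=> fl; have f0 : f 0 = 0.
  by apply: (addrI (f 0)); rewrite -{1}[f 0]scale1r -fl scale1r !addr0.
split=> [u v|c u]; first by rewrite -{1}[u]scale1r fl scale1r.
by rewrite -[c *: u]addr0 fl f0 addr0.
Qed.

Let brDl x x' y := (linearDZ (gap_bracket_linearl y)).1 x x'.
Let brZl c x y := (linearDZ (gap_bracket_linearl y)).2 c x.
Let brDr x := (linearDZ (gap_bracket_linearr x)).1.
Let brZr c x := (linearDZ (gap_bracket_linearr x)).2 c.

Fact gap_bracket_alternating x : gap_bracket x x = 0.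
Proof.
exact: (gap_alternating_subproof brDl brZl brDr brZr gap_bracketE gap_basis_ind).
Qed.

Fact gap_bracket_jacobi x y z :
  gap_bracket x (gap_bracket y z) + gap_bracket y (gap_bracket z x)
  + gap_bracket z (gap_bracket x y) = 0.
Proof.
exact: (gap_jacobi_subproof brDl brZl brDr brZr gap_bracketE gap_basis_ind).
Qed.

Lemma gap_act_subproof (W : lmodType F) (act : g -> W -> W) :
  (forall w, linear (act^~ w)) -> (forall x, linear (act x)) ->
  (forall a b w, act (gap_bracket_basis e a b) w
                 = act (e a) (act (e b) w) - act (e b) (act (e a) w)) ->
  forall x y w, act (gap_bracket x y) w = act x (act y w) - act y (act x w).
Proof.
exact: (gap_module_subproof brDl brZl brDr brZr gap_bracketE gap_basis_ind).
Qed.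

HB.instance Definition _ :=
  Lmodule_isLieAlgebra.Build F (gap_vir F p) gap_bracket_linearl
    gap_bracket_linearr gap_bracket_alternating gap_bracket_jacobi.

End GapVirasoro.

(* Evaluation at t + c is composition with 'X + c%:P, and [Ordinal (ltnW p_gt1)]
   is the index 0 of 'I_p. *)
Section Omega.
Variables (F : numFieldType) (p : nat) (p_gt1 : (1 < p)%N).
Variables (lambda : F) (lambda_neq0 : lambda != 0) (alpha : 'rV[F]_p).

Local Notation e := (@gap_basis F p).

Definition Omega_act_basis (k : gap_index p) (f : {poly F}) : {poly F} :=
  match k with
  | gapL n =>
      lambda ^ n *: (('X + (alpha 0 (Ordinal (ltnW p_gt1)) * n%:~R)%:P)
                     * (f \Po ('X + n%:~R%:P)))
  | gapI n i =>
      (alpha 0 (val i) * lambda ^ n)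
      *: (f \Po ('X + (n%:~R + (val i)%:R / p%:R)%:P))
  | gapC _ => 0
  end.

Definition Omega_act (x : gap_vir F p) (f : {poly F}) : {poly F} :=
  lin_ext (fun k => Omega_act_basis k f) x.

Lemma Omega_actE k f : Omega_act (e k) f = Omega_act_basis k f.
Proof. exact: lin_ext_basis. Qed.

Fact Omega_linearl f : linear (Omega_act^~ f).
Proof. by move=> c x y; rewrite /Omega_act linearP. Qed.

Fact Omega_linearr x : linear (Omega_act x).
Proof.
move=> c f f'; rewrite /Omega_act -lin_ext_linear_fun.
congr lin_ext; apply/funext => -[n|n i|j] /=; last by rewrite scaler0 addr0.
- by rewrite linearP /= mulrDr scalerDr -scalerAr !scalerA mulrC.
- by rewrite linearP /= scalerDr !scalerA [c * _]mulrC.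
Qed.

Let shiftD (c d : F) f :
  (f \Po ('X + c%:P)) \Po ('X + d%:P) = f \Po ('X + (c + d)%:P).
Proof.
by rewrite -comp_polyA comp_polyD comp_polyX comp_polyC polyCD addrA addrAC
  -!addrA [d%:P + _]addrC.
Qed.

Let act0l f : Omega_act 0 f = 0.
Proof. by rewrite /Omega_act linear0. Qed.

Let actZ c k f : Omega_act (c *: e k) f = c *: Omega_act_basis k f.
Proof. by rewrite -[c *: _]addr0 Omega_linearl act0l addr0 Omega_actE. Qed.

Fact Omega_bracket_basis a b f :
  Omega_act (gap_bracket_basis e a b) f
  = Omega_act (e a) (Omega_act (e b) f) - Omega_act (e b) (Omega_act (e a) f).
Proof.
rewrite !Omega_actE.
case: a b => [m|m i|j] [n|n i'|j'] /=;
  rewrite ?act0l ?comp_poly0 ?mulr0 ?scaler0 ?subr0 //.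
- rewrite Omega_linearl actZ !Omega_actE /= scaler0 addr0 expfzDr //.
  rewrite !(comp_polyZ, comp_polyM, comp_polyD, comp_polyX, comp_polyC).
  rewrite !shiftD ![n%:~R + m%:~R]addrC -rmorphD /=.
  rewrite rmorphB rmorphD /= -!mul_polyC !(polyCN, polyCM, polyCD).
  by move: (f \Po _) => h; ring.
- rewrite actZ /= expfzDr //.
  rewrite !(comp_polyZ, comp_polyM, comp_polyD, comp_polyX, comp_polyC) !shiftD.
  rewrite (_ : n%:~R + _ + m%:~R = (m + n)%:~R + (sval i')%:R / p%:R); last first.
    by rewrite rmorphD /=; ring.
  rewrite (_ : m%:~R + (n%:~R + _) = (m + n)%:~R + (sval i')%:R / p%:R); last first.
    by rewrite rmorphD /=; ring.
  rewrite -!mul_polyC !(polyCN, polyCM, polyCD).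
  by move: (f \Po _) => h; ring.
- rewrite actZ /= expfzDr //.
  rewrite !(comp_polyZ, comp_polyM, comp_polyD, comp_polyX, comp_polyC) !shiftD.
  rewrite (_ : m%:~R + _ + n%:~R = (n + m)%:~R + (sval i)%:R / p%:R); last first.
    by rewrite rmorphD /=; ring.
  rewrite (_ : n%:~R + (m%:~R + _) = (n + m)%:~R + (sval i)%:R / p%:R); last first.
    by rewrite rmorphD /=; ring.
  rewrite -!mul_polyC !(polyCN, polyCM, polyCD).
  by move: (f \Po _) => h; ring.
- rewrite actZ /= scaler0 !comp_polyZ !shiftD [n%:~R + _ + _]addrC.
  by rewrite !scalerA [X in _ - X *: _]mulrC subrr.
Qed.

Definition Omega : lieModule (gap_vir F p) :=
  LieModule Omega_linearl Omega_linearr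
    (gap_act_subproof Omega_linearl Omega_linearr Omega_bracket_basis).

End Omega.

Arguments Omega {F p} p_gt1 lambda lambda_neq0 alpha.

(* Main.v *)
Require Import Defs.
From mathcomp Require Import all_boot all_order all_algebra.
From mathcomp Require Import boolp classical_sets reals.
From mathcomp Require Import complex.

(** The operators L_n and I_n^(i) applied to a fixed polynomial f depend on n,
    after division by lambda^n, polynomially: they are the values at y = n of
    (t + alpha_0 y) f(t + y) and of alpha_i f(t + y + i/p). A subspace that
    contains the values of a polynomial in y at all natural numbers contains
    its coefficients, by inverting a Vandermonde matrix
    ([lead_coef_lin_closed]). A submodule containing f <> 0 therefore contains
    the leading coefficients in y, namely lead(f) alpha_0 (or lead(f) t, when
    alpha_0 = 0), and lead(f) when some alpha_i with i > 0 is nonzero.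

    Since L_0 multiplies by t whatever alpha is, every submodule is an ideal of
    the polynomial ring. If alpha <> 0, a nonzero submodule then contains a
    nonzero constant and is everything ([Omega_submodule_full]). If alpha = 0,
    the ideal generated by t is a proper submodule, and each nonzero submodule
    contains t, hence that ideal ([tOmega_min]). So this ideal is the least
    nonzero submodule, which makes it irreducible; it is also contained in, so
    equal to, any other irreducible submodule. *)

Set Implicit Arguments.
Unset Strict Implicit.
Unset Printing Implicit Defensive.

Import Order.TTheory GRing.Theory Num.Theory.
Local Open Scope ring_scope.

(** * Subspaces of polynomials *)

Section LinearSets.
Variables (F : numFieldType) (V : set {poly F}).
Hypothesis V0 : V 0.
Hypothesis V_lin : forall (c : F) (v w : {poly F}), V v -> V w -> V (c *: v + w).

Lemma lin_closedZ (c : F) v : V v -> V (c *: v).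
Proof. by move=> Vv; rewrite -[c *: v]addr0; exact: V_lin. Qed.

Lemma lin_closedZI (c : F) v : c != 0 -> V (c *: v) -> V v.
Proof. by move=> c0 /(lin_closedZ c^-1); rewrite scalerA mulVf // scale1r. Qed.

Lemma lin_closed_sum (I : Type) (r : seq I) (c : I -> F) (v : I -> {poly F}) :
  (forall i, V (v i)) -> V (\sum_(i <- r) c i *: v i).
Proof.
move=> Vv; elim: r => [|i r IHr]; first by rewrite big_nil.
by rewrite big_cons; exact: V_lin.
Qed.

(** With n = size G, the values of G at 0, ..., n - 1 are the image of its
    coefficients under an invertible Vandermonde matrix, so each coefficient is
    a scalar combination of values. *)
Lemma lead_coef_lin_closed (G : {poly {poly F}}) :
  (forall n : nat, V G.[n%:R]) -> V (lead_coef G).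
Proof.
move=> VG; have [->|G0] := eqVneq G 0; first by rewrite lead_coef0.
pose m := size G; pose A := Vandermonde m (\row_(j < m) (j%:R : F)).
have A_unit : A \in unitmx.
  rewrite unitmxE det_Vandermonde unitfE; apply/prodf_neq0 => i _.
  apply/prodf_neq0 => j ltij; rewrite !mxE subr_eq0 eqr_nat.
  by rewrite neq_ltn ltij orbT.
have lt_m : ((size G).-1 < m)%N by rewrite ltn_predL size_poly_gt0.
pose b (j : 'I_m) := invmx A j (Ordinal lt_m).
suff -> : lead_coef G = \sum_j b j *: G.[(j : nat)%:R].
  by apply: lin_closed_sum => j; exact: VG.
transitivity (\sum_(k < m) (\sum_j A k j * b j) *: G`_k).
  transitivity (\sum_(k < m) (k == Ordinal lt_m)%:R *: G`_k).
    rewrite (bigD1 (Ordinal lt_m)) //= eqxx scale1r big1 ?addr0 //.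
    by move=> k /negPf->; rewrite scale0r.
  apply: eq_bigr => k _; congr (_ *: _).
  by have := congr1 (fun B : 'M_m => B k (Ordinal lt_m)) (mulmxV A_unit); rewrite !mxE.
under eq_bigr do rewrite scaler_suml.
rewrite exchange_big /=; apply: eq_bigr => j _.
rewrite horner_coef scaler_sumr; apply: eq_bigr => k _.
rewrite !mxE mulrC -scalerA; congr (_ *: _).
by rewrite -!natrX mulr_natr scaler_nat.
Qed.

Lemma mulX_closed_ideal (g f : {poly F}) :
  (forall h, V h -> V ('X * h)) -> V g -> V (g * f).
Proof.
move=> VX Vg; elim/poly_ind: f => [|f c IHf]; first by rewrite mulr0.
rewrite mulrDr mulrA (mulrC _ 'X) (mulrC g c%:P) mul_polyC addrC; apply: V_lin => //.
exact: VX.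
Qed.

End LinearSets.

(** * Submodules of a Lie module *)

Section Submodules.
Variables (K : fieldType) (g : lieAlgType K) (M : lieModule g).

Lemma lieSubmodule_eq (N N' : lieSubmodule M) : N = N' :> set M -> N = N'.
Proof.
case: N N' => [A A0 Al Aa] [B B0 Bl Ba] /= AB; case: B / AB B0 Bl Ba => *.
by congr LieSubmodule; exact: Prop_irrelevance.
Qed.

(** Submodules of N, seen as a module in its own right, correspond to the
    submodules of M inside N through the inclusion map; this removes the
    subtype from every question of irreducibility. *)
Lemma irreducible_as_moduleP (N : lieSubmodule M) :
  irreducible (as_module N) <->
  (exists2 v : M, lsm_set N v & v <> 0) /\
  forall N' : lieSubmodule M, (N' `<=` N)%classic ->
    N' = [set 0]%classic :> set M \/ N' = N :> set M.
Proof.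
split=> [[[v v0] Nmin]|[[v Nv v0] Nmin]].
  split; first by exists (val v); [exact/set_mem/(valP v)|
    move=> e; apply: v0; exact: val_inj].
  move=> N' N'N.
  pose B : set (as_module N) := [set u | lsm_set N' (val u)]%classic.
  have [B0 Bl Ba] : [/\ B 0,
      forall (c : K) u w, B u -> B w -> B (c *: u + w)
    & forall x u, B u -> B (lm_act x u)].
    split; first exact: lsm_0.
      by move=> c u w Bu Bw; exact: lsm_linear.
    by move=> x u Bu; exact: lsm_act.
  have [/= BE|/= BE] := Nmin (LieSubmodule B0 Bl Ba); [left|right].
    apply/seteqP; split=> [u N'u|_ ->]; last exact: lsm_0.
    have : B (Sub u (mem_set (N'N _ N'u))) by [].
    by rewrite BE => /(congr1 val).
  apply/seteqP; split=> // u Nu.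
  by have : B (Sub u (mem_set Nu)) by rewrite BE.
split; first by exists (Sub v (mem_set Nv)) => /(congr1 val).
move=> N'; pose B : set M := [set u | exists2 w, lsm_set N' w & val w = u]%classic.
have [B0 Bl Ba] : [/\ B 0,
    forall (c : K) u w, B u -> B w -> B (c *: u + w)
  & forall x u, B u -> B (lm_act x u)].
  split; first by exists 0 => //; exact: lsm_0.
    move=> c _ _ [u N'u <-] [w N'w <-].
    by exists (c *: u + w) => //; exact: lsm_linear.
  by move=> x _ [u N'u <-]; exists (lm_act x u) => //; exact: lsm_act.
have BN : (B `<=` N)%classic by move=> _ [w _ <-]; exact/set_mem/(valP w).
have [/= BE|/= BE] := Nmin (LieSubmodule B0 Bl Ba) BN; [left|right].
  apply/seteqP; split=> [u N'u|_ ->]; last exact: lsm_0.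
  have : B (val u) by exists u.
  by rewrite BE => u0; exact: val_inj.
apply/seteqP; split=> // u _.
have : B (val u) by rewrite BE; exact/set_mem/(valP u).
by case=> w N'w /val_inj <-.
Qed.

Lemma lieSubmodule_neq0 (N : lieSubmodule M) :
  lsm_set N <> [set 0]%classic -> exists2 v, lsm_set N v & v != 0.
Proof.
move=> nz; apply: contrapT => nex; apply: nz; apply/seteqP.
split=> [v Nv|_ ->]; last exact: lsm_0.
by apply: contrapT => /eqP v0; apply: nex; exists v.
Qed.

End Submodules.

(** * Nonzero submodules of Omega *)

Section OmegaSubmodules.
Variables (F : numFieldType) (p : nat) (p_gt1 : (1 < p)%N).
Variables (lambda : F) (lambda_neq0 : lambda != 0) (alpha : 'rV[F]_p).

Local Notation Om := (Omega p_gt1 lambda lambda_neq0 alpha).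
Local Notation alpha0 := (alpha 0 (Ordinal (ltnW p_gt1))).

Variable N : lieSubmodule Om.

Let N0 : lsm_set N 0. Proof. exact: lsm_0. Qed.

Let N_lin (c : F) (v w : {poly F}) :
  lsm_set N v -> lsm_set N w -> lsm_set N (c *: v + w : {poly F}).
Proof. exact: lsm_linear. Qed.

Let N_act k (f : {poly F}) :
  lsm_set N f -> lsm_set N (Omega_act_basis p_gt1 lambda alpha k f).
Proof.
by move/(@lsm_act _ _ _ N (gap_basis F k)); rewrite /= Omega_actE.
Qed.

Let N_shiftL (n : nat) (f : {poly F}) :
  lsm_set N f -> lsm_set N (('X + (alpha0 * n%:R)%:P) * (f \Po ('X + n%:R%:P))).
Proof.
move=> /(N_act (gapL (n : int))) /=.
by apply: (lin_closedZI N0 N_lin); rewrite expfz_neq0.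
Qed.

Let N_mulX (f : {poly F}) : lsm_set N f -> lsm_set N ('X * f).
Proof.
by move=> /(N_shiftL 0); rewrite mulr0 addr0 comp_polyXr.
Qed.

(** L_0 acts as multiplication by t, for every alpha. *)
Lemma Omega_submodule_ideal (h f : {poly F}) : lsm_set N h -> lsm_set N (h * f).
Proof. exact: mulX_closed_ideal. Qed.

(** The bivariate polynomial is (t + alpha_0 y) f(t + y), with y the outer
    variable: at y = n it is lambda^(-n) L_n f. Its leading coefficient is
    lead(f) alpha_0 if alpha_0 <> 0, and lead(f) t if alpha_0 = 0. *)
Lemma Omega_submodule_lead_coef (f : {poly F}) : lsm_set N f ->
  lsm_set N (lead_coef (('X%:P + alpha0%:P *: 'X) * poly_XaY f)).
Proof.
move=> Nf; apply: (lead_coef_lin_closed N0 N_lin) => n.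
rewrite !hornerE horner_poly_XaY /= [_ + 'X]addrC.
by rewrite -!polyC_natr -polyCM; exact: N_shiftL.
Qed.

(** At y = n, the polynomial f(t + y + i/p) is a nonzero multiple of
    I_n^(i) f; its leading coefficient in y is that of f. *)
Lemma Omega_submodule_lead_coefI (i : 'I_p) (f : {poly F}) : (0 < i)%N ->
  alpha 0 i != 0 -> lsm_set N f -> lsm_set N (lead_coef f)%:P.
Proof.
move=> i_gt0 ai0 Nf.
pose c : F := (i : nat)%:R / p%:R.
have -> : (lead_coef f)%:P = lead_coef (poly_XaY (f \Po ('X + c%:P))).
  rewrite lead_coef_poly_XaY lead_coef_comp ?size_XaddC //.
  by rewrite lead_coefXaddC expr1n mulr1.
apply: (lead_coef_lin_closed N0 N_lin) => n.
rewrite horner_poly_XaY -comp_polyA comp_polyD comp_polyX comp_polyC.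
rewrite -polyC_natr [_ + 'X]addrC -addrA -polyCD.
have /= := N_act (gapI (n : int) (exist _ i i_gt0)) Nf.
by apply: (lin_closedZI N0 N_lin); rewrite mulf_neq0 // expfz_neq0.
Qed.

(** The operators L_n produce a nonzero constant if alpha_0 <> 0, and the
    operators I_n^(i) do if alpha_i <> 0 for some i > 0. *)
Lemma Omega_submodule_full (f : {poly F}) :
  alpha <> 0 -> lsm_set N f -> f != 0 ->
  N = setT :> set {poly F}.
Proof.
move=> alpha_neq0 Nf f0; apply/seteqP; split=> // h _.
suff Nl : lsm_set N (lead_coef f)%:P.
  have /(Omega_submodule_ideal h) := (lin_closedZ N0 N_lin (lead_coef f)^-1 Nl).
  by rewrite -mul_polyC -polyCM mulVf ?lead_coef_eq0 // mul1r.
have [a0|a0] := eqVneq alpha0 0; last first.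
  have := Omega_submodule_lead_coef Nf.
  rewrite lead_coefM lead_coef_poly_XaY lead_coefDr; last first.
    rewrite size_scale ?polyC_eq0 // size_polyX.
    by rewrite size_polyC; case: (_ != 0).
  rewrite lead_coefZ lead_coefX mulr1 mul_polyC.
  exact: (lin_closedZI N0 N_lin).
have [i ai0] : exists i, alpha 0 i != 0.
  apply/existsP; apply: contra_notT alpha_neq0; rewrite negb_exists.
  by move=> /forallP a; apply/rowP => i; rewrite mxE; exact/eqP/negbNE/a.
apply: (@Omega_submodule_lead_coefI i) => //.
rewrite lt0n; apply: contraNneq ai0 => i0; rewrite -a0.
by apply/eqP; congr (alpha 0 _); exact: val_inj.
Qed.

(** For alpha_0 = 0, the leading coefficient of t f(t + y) in y is a nonzero
    multiple of t. *)
Lemma Omega_submodule_mulX (f : {poly F}) :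
  alpha0 = 0 -> lsm_set N f -> f != 0 ->
  forall h : {poly F}, lsm_set N ('X * h : {poly F}).
Proof.
move=> a0 Nf f0 h; apply: Omega_submodule_ideal.
have := Omega_submodule_lead_coef Nf.
rewrite a0 scale0r addr0 lead_coefM lead_coef_poly_XaY lead_coefC.
rewrite mulrC mul_polyC.
by apply: (lin_closedZI N0 N_lin); rewrite lead_coef_eq0.
Qed.

End OmegaSubmodules.

(** * The submodule generated by t for zero parameters *)

Section OmegaZero.
Variables (F : numFieldType) (p : nat) (p_gt1 : (1 < p)%N).
Variables (lambda : F) (lambda_neq0 : lambda != 0).

Local Notation Om := (Omega p_gt1 lambda lambda_neq0 0).

Let tC : set {poly F} := [set 'X * f | f in [set: {poly F}]]%classic.

Let tC0 : tC 0. Proof. by exists 0; rewrite ?mulr0. Qed.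

Let tC_lin (c : F) (v w : {poly F}) : tC v -> tC w -> tC (c *: v + w).
Proof.
by move=> [f _ <-] [h _ <-]; exists (c *: f + h); rewrite // mulrDr scalerAr.
Qed.

(* For zero parameters each L_n has values divisible by t, and each I_n^(i)
   vanishes. *)
Let tC_act (x : gap_vir F p) (v : {poly F}) :
  tC v -> tC (Omega_act p_gt1 lambda 0 x v).
Proof.
move=> _; elim/gap_basis_ind: x => [|c k x IHx].
  by rewrite /Omega_act linear0.
rewrite Omega_linearl; apply: tC_lin => //; rewrite Omega_actE.
case: k => [n|n i|j] //=; rewrite mxE.
  by rewrite mul0r addr0 scalerAr; eexists.
by rewrite mul0r scale0r.
Qed.

Definition tOmega : lieSubmodule Om := @LieSubmodule _ _ Om tC tC0 tC_lin tC_act.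

Lemma tOmega_min (N : lieSubmodule Om) (f : {poly F}) :
  lsm_set N f -> f != 0 -> (tOmega `<=` N)%classic.
Proof.
by move=> Nf f0 _ [h _ <-]; apply: Omega_submodule_mulX Nf f0 _; rewrite mxE.
Qed.

Lemma tOmega_neq0 : lsm_set tOmega <> [set 0]%classic.
Proof.
move=> t0; have : lsm_set tOmega 'X by exists 1; rewrite ?mulr1.
by rewrite t0 => /eqP; rewrite polyX_eq0.
Qed.

Lemma tOmega_neqT : lsm_set tOmega <> setT.
Proof.
move=> tT; have : lsm_set tOmega 1 by rewrite tT.
case=> h _ /(congr1 (fun q : {poly F} => q.[0])).
by rewrite hornerM hornerX mul0r hornerC => /esym/eqP; rewrite oner_eq0.
Qed.

End OmegaZero.

Theorem proposition4p2 (R : realType) (p : nat) (p_gt1 : (1 < p)%N)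
    (lambda : R[i]) (lambda_neq0 : lambda != 0) :
  (exists N : lieSubmodule (Omega p_gt1 lambda lambda_neq0 0),
    [/\ N = [set 'X * f | f in [set: {poly R[i]}]]%classic :> set {poly R[i]},
        irreducible (as_module N)
      & forall N' : lieSubmodule (Omega p_gt1 lambda lambda_neq0 0),
          irreducible (as_module N') -> N' = N])
  /\
  (forall alpha : 'rV[R[i]]_p,
    irreducible (Omega p_gt1 lambda lambda_neq0 alpha) <-> alpha <> 0).
Proof.
split.
  exists (tOmega p_gt1 lambda_neq0); split=> //.
    apply/irreducible_as_moduleP; split.
      have [f tf f0] := lieSubmodule_neq0 (@tOmega_neq0 _ _ p_gt1 _ lambda_neq0).
      by exists f => //; exact/eqP.
    move=> N' N't.
    have [->|nz] := pselect (lsm_set N' = [set 0]%classic); [by left|right].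
    have [f N'f f0] := lieSubmodule_neq0 nz.
    by apply/seteqP; split=> //; exact: tOmega_min N'f f0.
  move=> N' /irreducible_as_moduleP [[f N'f /eqP f0] N'min].
  apply: lieSubmodule_eq.
  by have [/tOmega_neq0|//] := N'min _ (tOmega_min N'f f0).
move=> alpha; split=> [[_ Nmin] alpha0|alpha0].
  subst alpha.
  by have [/tOmega_neq0|/tOmega_neqT] := Nmin (tOmega p_gt1 lambda_neq0).
split; first by exists (1 : {poly R[i]}); exact/eqP/oner_neq0.
move=> N; have [->|nz] := pselect (lsm_set N = [set 0]%classic); [by left|right].
have [f Nf f0] := lieSubmodule_neq0 nz.
exact: Omega_submodule_full alpha0 Nf f0.
Qed.
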